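(* Let $X$ be a reflexive symmetric sequence space. (i) If the discrete Cesàro operator $C_d$ is bounded on $X$, then $CX$ does not have the Dunford–Pettis property. (ii) If $C_d$ is bounded on the Köthe dual $X'$, then $\widetilde X$ does not have the Dunford–Pettis property.
   Context: A Banach ideal sequence space is a Banach space $X$ of real sequences such that $|x|\le|y|$ coordinatewise with $y\in X$ implies $x\in X$, $\|x\|\le\|y\|$ (and $X$ contains a sequence with all coordinates nonzero); it is symmetric if $x\in X$ and $y$ equimeasurable with $x$ (i.e., $|y|$ and $|x|$ have the same decreasing rearrangement) imply $y\in X$, $\|y\|=\|x\|$. Köthe dual: $X'=\{y:\sup_{\|x\|_X\le1}\sum|x_ny_n|<\infty\}$ with that supremum as norm. $(C_dx)_n=\frac1n\sum_{k=1}^nx_k$; $CX=\{x:C_d|x|\in X\}$, $\|x\|_{CX}=\|C_d|x|\|_X$; with $\widetilde{x_n}=\sup_{k\ge n}|x_k|$, $\widetilde X=\{x:(\widetilde{x_n})\in X\}$, $\|x\|_{\widetilde X}=\|(\widetilde{x_n})\|_X$. Dunford–Pettis property: $x_n\to0$ weakly in $Y$ and $y_n^*\to0$ weakly in $Y^*$ imply $y_n^*(x_n)\to0$. *)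

(* Defs.v *)
From HB Require Import structures.
From mathcomp Require Import all_boot all_order all_algebra.
From mathcomp Require Import all_classical all_reals all_analysis.
Set Implicit Arguments. Unset Strict Implicit. Unset Printing Implicit Defensive.
Import Order.TTheory GRing.Theory Num.Theory.
Import numFieldNormedType.Exports.
Local Open Scope classical_set_scope.
Local Open Scope ring_scope.
Local Open Scope ereal_scope.

(* A (quasi-)normed space of real sequences is encoded by an extended-valued
   function N : (nat -> R) -> \bar R; the space itself is {x | N x < +oo}
   and N restricted to it is its norm. *)

Section Defs.
Variable R : realType.
Implicit Types (N : (nat -> R) -> \bar R) (x y : nat -> R).

Definition inX N x := N x < +oo.

Definition lincomb (a b : R) x y : nat -> R := fun n => (a * x n + b * y n)%R.

Definition banach_ideal_space N :=
  (forall x, 0 <= N x) /\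
  (forall x, N x = 0 -> forall n, x n = 0%R) /\
  (forall (a : R) x, N (fun n => (a * x n)%R) = (`|a|)%:E * N x) /\
  (forall x y, N (fun n => (x n + y n)%R) <= N x + N y) /\
  (forall x y, (forall n, (`|x n| <= `|y n|)%R) -> N x <= N y) /\
  (exists x, inX N x /\ forall n, x n != 0%R) /\
      (forall u : nat -> nat -> R, (forall m, inX N (u m)) ->
        (forall e : R, (0 < e)%R -> exists M, forall m k, (M <= m)%N -> (M <= k)%N ->
            N (fun n => (u m n - u k n)%R) < e%:E) ->
        exists x, inX N x /\
          forall e : R, (0 < e)%R -> exists M, forall m, (M <= m)%N ->
            N (fun n => (u m n - x n)%R) < e%:E).

(* discrete decreasing rearrangement of |x| :
   x^*(n) = inf { s >= 0 : #{k : |x k| > s} <= n } (in \bar R, inf of empty = +oo) *)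
Definition rearr x (n : nat) : \bar R :=
  ereal_inf [set s%:E | s in [set s : R | (0 <= s)%R /\
     exists l : seq nat, (size l <= n)%N /\
       [set k | (s < `|x k|)%R] `<=` [set` l]]].

Definition equimeasurable x y := rearr x = rearr y.

Definition symmetric_space N :=
  forall x y, equimeasurable x y -> N y = N x.

(* discrete Cesaro operator, 0-indexed: (C_d x)_n = 1/(n+1) sum_{k<=n} x_k *)
Definition Cd x : nat -> R :=
  fun n => ((n.+1%:R)^-1 * \sum_(k < n.+1) x k)%R.

Definition cesaro_bounded N :=
  exists c : R, forall x, inX N x -> N (Cd x) <= c%:E * N x.

Definition cesaro_space N : (nat -> R) -> \bar R :=
  fun x => N (Cd (fun n => `|x n|%R)).

(* \tilde X, with \tilde x_n = sup_{k >= n} |x_k| ; unbounded x are not in it *)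
Definition tilde_space N : (nat -> R) -> \bar R :=
  fun x => if `[< exists M : R, forall k, (`|x k| <= M)%R >]
           then N (fun n => sup [set `|x k|%R | k in [set k | (n <= k)%N]])
           else +oo.

Definition kothe_dual N : (nat -> R) -> \bar R :=
  fun y => ereal_sup [set (\sum_(0 <= n <oo) (`|x n * y n|%R)%:E) | x in
                       [set x | N x <= 1]].

Definition dual_elt N (f : (nat -> R) -> R) :=
  (forall (a b : R) x y, inX N x -> inX N y ->
      f (lincomb a b x y) = (a * f x + b * f y)%R) /\
  exists c : R, forall x, inX N x -> (`|f x|%R)%:E <= c%:E * N x.

Definition dual_bound N (f : (nat -> R) -> R) (M : R) :=
  forall x, inX N x -> (`|f x|%R)%:E <= M%:E * N x.

Definition bidual_elt N (Phi : ((nat -> R) -> R) -> R) :=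
  (forall (a b : R) f g, dual_elt N f -> dual_elt N g ->
      Phi (fun x => a * f x + b * g x)%R = (a * Phi f + b * Phi g)%R) /\
  exists c : R, forall f (M : R), dual_elt N f -> (0 <= M)%R -> dual_bound N f M ->
      (`|Phi f| <= c * M)%R.

Definition reflexive_space N :=
  forall Phi, bidual_elt N Phi ->
    exists x, inX N x /\ forall f, dual_elt N f -> Phi f = f x.

Definition weakly_null N (u : nat -> nat -> R) :=
  (forall m, inX N (u m)) /\
  forall f, dual_elt N f -> (fun m => f (u m)) @ \oo --> 0%R.

Definition weakly_null_dual N (F : nat -> (nat -> R) -> R) :=
  (forall m, dual_elt N (F m)) /\
  forall Phi, bidual_elt N Phi -> (fun m => Phi (F m)) @ \oo --> 0%R.

Definition dunford_pettis N :=
  forall u F, weakly_null N u -> weakly_null_dual N F ->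
    (fun m => F m (u m)) @ \oo --> 0%R.

End Defs.

(* Main.v *)
Require Import Defs.
From mathcomp Require Import all_boot all_order all_algebra.
From mathcomp Require Import all_classical all_reals all_analysis.
From mathcomp Require Import zify ring lra.

(** In a reflexive space X of sequences, ultralimits of bounded sequences of
    vectors stay in X. Hence bounded coordinatewise null sequences are weakly
    null, and bounded sequences of functionals that vanish eventually on
    finitely supported vectors are weakly null in X*. For disjoint intervals
    D_j this applies to the normalised indicators v_j = 1_{D_j} / ||1_{D_j}||
    and to the functionals g_j(x) = ||1_{D_j}|| * mean_{D_j}(x), which are
    contractive because averaging over D_j is a mean of cyclic shifts.

    (i) If C_d is bounded on X then X embeds in CX, so the v_j are weakly null
    in CX; g_j o C_d is weakly null in (CX)*, and for dyadic D_j its value at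
    v_j is at least 1/4.

    (ii) Since ||1_{[0,n)}|| tends to infinity, the D_j can be chosen so sparse
    that the block averaging projections are uniformly bounded from X to the
    tilde space. So the v_j are weakly null there, the g_j are weakly null in
    its dual, and g_j(v_j) = 1. *)

Set Implicit Arguments.
Unset Strict Implicit.
Unset Printing Implicit Defensive.

Import Order.TTheory GRing.Theory Num.Theory.
Import numFieldNormedType.Exports.

Local Open Scope classical_set_scope.
Local Open Scope ring_scope.

(** * Limits of real sequences along ultrafilters *)

Section UltrafilterLimits.
Variable R : realType.
Implicit Types (s : nat -> R) (U : set_system nat).

(** Compactness of [[-K, K]] yields a cluster point, and along an ultrafilter a cluster point is a
    limit. *)
Lemma ultra_bounded_cvg U s (K : R) : UltraFilter U ->
  (forall m, `|s m| <= K) -> cvg (s @ U).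
Proof.
move=> UF sK; have UP : ProperFilter U := @ultra_proper _ U UF.
have UK : (s @ U) [set` `[- K, K]].
  by apply: (@filterE _ U) => m /=; rewrite in_itv /= -ler_norml.
have [p [_ clp]] := segment_compact _ UK.
apply/cvg_ex; exists p => A pA.
case: (in_ultra_setVsetC (s @^-1` A) UF) => // UnA.
by have [y [nAy Ay]] := clp (~` A) A UnA pA.
Qed.

(** If [s] is not eventually in a neighbourhood [A] of [l], the trace of [\oo] on the complement of
    the preimage of [A] is proper; an ultrafilter above it contradicts the hypothesis. *)
Lemma cvg_ultra s (l : R) :
  (forall U, UltraFilter U -> \oo `<=` U -> s @ U --> l) -> s @ \oo --> l.
Proof.
move=> sU A lA; apply: contrapT => nA.
have FP : ProperFilter (within (~` (s @^-1` A)) \oo).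
  apply: Build_ProperFilter => -[n _ nP]; apply: nA; exists n => // m /= nm.
  by apply: contrapT => nAm; exact: (nP m nm nAm).
have [U [UF sub]] := ultraFilterLemma FP.
have UP : ProperFilter U := @ultra_proper _ U UF.
have ooU : \oo `<=` U.
  by move=> B [n _ nB]; apply: sub; exists n => // m nm _; apply: nB.
have UA : U (s @^-1` A) by apply: (sU U UF ooU).
have UnA : U (~` (s @^-1` A)) by apply: sub; exists 0%N.
by apply: (@filter_not_empty _ U); rewrite -(setICr (s @^-1` A)); exact: filterI.
Qed.

End UltrafilterLimits.

(** * Ideal spaces: indicators, coordinates, ultralimits of functionals *)

Section IdealSpace.
Variables (R : realType) (N : (nat -> R) -> \bar R).
Hypothesis idealN : banach_ideal_space N.
Implicit Types (x y : nat -> R).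

Local Notation nrm x := (fine (N x)).

Lemma norm_ge0 x : (0 <= N x)%E.
Proof. by case: idealN. Qed.

Lemma normZ (a : R) x : N (fun n => a * x n) = (`|a|%:E * N x)%E.
Proof. by case: idealN => _ [_ [h _]]. Qed.

Lemma le_normD x y : (N (fun n => x n + y n)%R <= N x + N y)%E.
Proof. by case: idealN => _ [_ [_ [h _]]]. Qed.

Lemma le_norm x y : (forall n, `|x n| <= `|y n|) -> (N x <= N y)%E.
Proof. by case: idealN => _ [_ [_ [_ [h _]]]]; exact: h. Qed.

Lemma norm0 : N (fun=> 0) = 0%E.
Proof.
have := normZ 0 (fun=> 0); rewrite normr0 mul0e => <-.
by congr N; apply/funext => n; rewrite mul0r.
Qed.

Lemma inX_fin x : inX N x -> N x \is a fin_num.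
Proof. by move=> xN; rewrite ge0_fin_numE ?norm_ge0. Qed.

Lemma inXE x : inX N x -> N x = (nrm x)%:E.
Proof. by move=> /inX_fin /fineK. Qed.

Lemma inX_le x (c : R) : (N x <= c%:E)%E -> inX N x.
Proof. by move=> h; apply: le_lt_trans h (ltry _). Qed.

Lemma inXZ (a : R) x : inX N x -> inX N (fun n => a * x n).
Proof. by move=> xN; rewrite /inX normZ inXE // -EFinM ltry. Qed.

Lemma inXD x y : inX N x -> inX N y -> inX N (fun n => x n + y n).
Proof.
move=> xN yN; apply: le_lt_trans (le_normD x y) _.
by rewrite inXE // (inXE yN) -EFinD ltry.
Qed.

Definition chi (a b : nat) : nat -> R := fun n => (a <= n < b)%N%:R.

(** Each step of the induction on [b] adds at most one coordinate, dominated by a multiple of the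
    nowhere vanishing element [w]. *)
Lemma inX_chi a b : inX N (chi a b).
Proof.
case: (idealN) => _ [_ [_ [_ [_ [[w [wN w0]] _]]]]].
elim: b => [|b IH].
  rewrite (_ : chi a 0 = fun=> 0) ?/inX ?norm0 ?ltry //.
  by apply/funext => n; rewrite /chi ltn0 andbF.
have abs x : inX N x -> inX N (fun n => `|x n|).
  by apply: le_lt_trans; apply: le_norm => n; rewrite normr_id.
apply: le_lt_trans (inXD (abs _ IH) (abs _ (inXZ (w b)^-1 wN))).
apply: le_norm => n; rewrite [leRHS]ger0_norm ?addr_ge0 //.
rewrite /chi; have [->|nb] := eqVneq n b.
  rewrite mulVf // normr1 ltnS leqnn andbT ltnn andbF normr0 add0r.
  by rewrite ger0_norm // lern1 leq_b1.
by rewrite ltnS [(n <= b)%N]leq_eqVlt (negPf nb) /= lerDl.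
Qed.

Lemma nrm_chi_gt0 a b : (a < b)%N -> 0 < nrm (chi a b).
Proof.
move=> ab; rewrite lt_neqAle fine_ge0 ?norm_ge0 // andbT eq_sym.
apply/eqP => h; have Nc : N (chi a b) = 0%E by rewrite inXE ?h //; exact: inX_chi.
case: idealN => _ [h0 _]; have := h0 _ Nc a.
by rewrite /chi leqnn ab => /eqP; rewrite oner_eq0.
Qed.

Lemma coord_le n x : inX N x -> `|x n| * nrm (chi n n.+1) <= nrm x.
Proof.
move=> xN; rewrite -lee_fin EFinM -!inXE //; last exact: inX_chi.
rewrite -normZ; apply: le_norm => k; rewrite /chi normrM normr_nat ltnS -eqn_leq.
by have [->|] := eqVneq n k; rewrite ?mulr1 ?mulr0.
Qed.

Lemma dual_elt_coord n : dual_elt N (fun x => x n).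
Proof.
split=> //; exists (nrm (chi n n.+1))^-1 => x xN.
rewrite (inXE xN) -EFinM lee_fin mulrC ler_pdivlMr ?coord_le //.
exact: nrm_chi_gt0.
Qed.

Lemma dual_elt0 f : dual_elt N f -> f (fun=> 0) = 0.
Proof.
move=> [_ [c /(_ (fun=> 0))]]; rewrite /inX norm0 mule0 lee_fin => /(_ (ltry _)).
by rewrite normr_le0 => /eqP.
Qed.

Lemma dual_eltB f x y : dual_elt N f -> inX N x -> inX N y ->
  f (fun n => x n - y n) = f x - f y.
Proof.
move=> [lf _] xN yN; have := lf 1 (-1) x y xN yN.
rewrite mul1r mulN1r => <-; congr f; apply/funext => n.
by rewrite /lincomb mul1r mulN1r.
Qed.

Lemma dual_boundE f (C : R) x : dual_bound N f C -> inX N x ->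
  `|f x| <= C * nrm x.
Proof. by move=> fC xN; rewrite -lee_fin EFinM -inXE //; exact: fC. Qed.

Section UltraLimit.
Variables (U : set_system nat) (UF : UltraFilter U).
Variables (g : nat -> (nat -> R) -> R) (C : R).
Hypothesis gN : forall m, dual_elt N (g m).
Hypothesis gC : forall m, dual_bound N (g m) C.

Lemma dual_ulim_cvg x : inX N x -> cvg (g m x @[m --> U]).
Proof.
move=> xN; apply: (@ultra_bounded_cvg _ _ _ (C * nrm x)) => m.
exact: dual_boundE.
Qed.

Lemma dual_elt_ulim : dual_elt N (fun x => lim (g m x @[m --> U])).
Proof.
have UP : ProperFilter U := @ultra_proper _ U UF.
split=> [a b x y xN yN|].
  have xc := dual_ulim_cvg xN; have yc := dual_ulim_cvg yN.
  apply/cvg_lim => //; under eq_fun do rewrite (proj1 (gN _)) //.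
  by apply: cvgD; apply: cvgM => //; exact: cvg_cst.
exists C => x xN; rewrite inXE // -EFinM lee_fin.
rewrite -lim_norm; last exact: dual_ulim_cvg.
apply: limr_le; first by apply: is_cvg_norm; exact: dual_ulim_cvg.
by apply: nearW => m; exact: dual_boundE.
Qed.

End UltraLimit.

End IdealSpace.

(** * Weak limits in a reflexive space and in its dual *)

Section ReflexiveSpace.
Variables (R : realType) (N : (nat -> R) -> \bar R).
Hypothesis idealN : banach_ideal_space N.
Hypothesis reflN : reflexive_space N.
Implicit Types (x y : nat -> R).

Local Notation nrm x := (fine (N x)).

Lemma dual_elt_bound f : dual_elt N f -> exists2 M : R, 0 <= M & dual_bound N f M.
Proof.
move=> [_ [c fc]]; exists `|c| => // x xN; apply: le_trans (fc x xN) _.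
by rewrite (inXE idealN xN) -!EFinM lee_fin ler_wpM2r ?ler_norm ?fine_ge0 ?norm_ge0.
Qed.

(** The ultralimit of [h (v m)], as a function of [h], is a bidual element; reflexivity represents
    it by a vector. *)
Lemma bounded_ulim U (v : nat -> nat -> R) (C : R) : UltraFilter U ->
  (forall m, N (v m) <= C%:E)%E ->
  exists2 x, inX N x &
    forall f, dual_elt N f -> f (v m) @[m --> U] --> f x.
Proof.
move=> UF vC; have vN m : inX N (v m) by exact: inX_le (vC m).
have nvC m : nrm (v m) <= C by rewrite -lee_fin -(inXE idealN).
have UP : ProperFilter U := @ultra_proper _ U UF.
have bnd h (M : R) : 0 <= M -> dual_bound N h M -> forall m, `|h (v m)| <= C * M.
  move=> M0 hM m; apply: le_trans (dual_boundE idealN hM (vN m)) _.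
  by rewrite mulrC ler_wpM2r.
have cv h : dual_elt N h -> cvg (h (v m) @[m --> U]).
  move=> /dual_elt_bound[M M0 hM].
  by apply: (@ultra_bounded_cvg _ _ _ (C * M)) => m; exact: bnd.
have [|x [xN xP]] := reflN (Phi := fun h => lim (h (v m) @[m --> U])).
  split=> [a b h k hN kN|].
    apply/cvg_lim => //.
    by apply: cvgD; apply: cvgM; [exact: cvg_cst|exact: cv|exact: cvg_cst|exact: cv].
  exists C => h M hN M0 hM; rewrite -lim_norm; last exact: cv.
  apply: limr_le; first by apply: is_cvg_norm; exact: cv.
  by apply: nearW => m; exact: bnd.
by exists x => // f fN; rewrite -xP //; exact: cv.
Qed.

(** Every weak ultralimit of [v] is a vector of the space, and the coordinate functionals identify
    it as 0. *)
Lemma weakly_null_coord (v : nat -> nat -> R) (C : R) :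
  (forall m, N (v m) <= C%:E)%E -> (forall n, v m n @[m --> \oo] --> 0) ->
  weakly_null N v.
Proof.
move=> vC v0; split=> [m|f fN]; first exact: inX_le (vC m).
apply: cvg_ultra => U UF ooU.
have UP : ProperFilter U := @ultra_proper _ U UF.
have [x xN xP] := bounded_ulim UF vC; rewrite -(dual_elt0 idealN fN).
rewrite (_ : (fun=> 0) = x); first exact: xP.
apply/funext => n; apply: (@cvg_unique _ _ (v m n @[m --> U])) => //.
  by apply: cvg_trans (v0 n); apply: cvg_app.
exact: xP (dual_elt_coord idealN n).
Qed.

(** An ultralimit [h] of the [g m] vanishes on the truncations of [x], so it takes the value [h x]
    on every tail [t n]. The tails are bounded and coordinatewise null, hence weakly null, which
    forces [h x = 0]. *)
Lemma dual_null (g : nat -> (nat -> R) -> R) (C : R) x :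
  (forall m, dual_elt N (g m)) -> (forall m, dual_bound N (g m) C) ->
  inX N x ->
  (forall n, g m (fun k => chi R 0 n k * x k) @[m --> \oo] --> 0) ->
  g m x @[m --> \oo] --> 0.
Proof.
move=> gN gC xN g0; apply: cvg_ultra => U UF ooU.
have UP : ProperFilter U := @ultra_proper _ U UF.
have cv := dual_ulim_cvg idealN UF gC; have hN := dual_elt_ulim idealN UF gN gC.
set h := (fun y => _) in hN.
have cN n : inX N (fun k => chi R 0 n k * x k).
  apply: le_lt_trans xN; apply: le_norm => // k.
  by rewrite normrM normr_nat ler_piMl // lern1 leq_b1.
pose t n k := x k - chi R 0 n k * x k.
have ht n : h (t n) = h x.
  rewrite (dual_eltB hN) // [h (fun k => chi _ _ _ _ * _)](_ : _ = 0) ?subr0 //.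
  by apply/cvg_lim => //; apply: cvg_trans (g0 n); apply: cvg_app.
have tC n : (N (t n) <= (nrm x)%:E)%E.
  rewrite -(inXE idealN) //; apply: le_norm => // k; rewrite /t /chi /=.
  by case: (k < n)%N; rewrite ?mul1r ?subrr ?normr0 // mul0r subr0.
have [|_ /(_ _ hN)] := weakly_null_coord tC.
  move=> n; apply: cvg_near_cst; exists n.+1 => // m /= nm.
  by rewrite /t /chi /= nm mul1r subrr.
under eq_fun do rewrite ht.
move=> h0; have <- : h x = 0 by apply: cvg_unique h0 => //; exact: cvg_cst.
exact: cv.
Qed.

End ReflexiveSpace.

(** * Equimeasurability under bijections, and averages as means of rotations *)

Section Rearrangement.
Variable R : realType.

(** A list covering a level set of one sequence is carried by the bijection to a list of the same
    length covering that of the other. *)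
Lemma rearr_comp (x : nat -> R) (s t : nat -> nat) :
  cancel s t -> cancel t s -> equimeasurable x (x \o s).
Proof.
have sub (y : nat -> R) (p q : nat -> nat) n c : cancel p q ->
    (exists l : seq nat, (size l <= n)%N /\
      [set k | c < `|y k|] `<=` [set` l]) ->
    exists l : seq nat, (size l <= n)%N /\
      [set k | c < `|(y \o p) k|] `<=` [set` l].
  move=> pq [l [ln yl]]; exists (map q l); split; first by rewrite size_map.
  by move=> k /= yk; rewrite -[k]pq; apply: map_f; exact: yl.
move=> st ts; apply/funext => n; congr (ereal_inf (EFin @` _)).
apply/seteqP; split=> c /= [c0 cl]; split=> //; first exact: sub st cl.
have := sub _ _ _ _ _ ts cl.
by rewrite (_ : (x \o s) \o t = x) //; apply/funext => k /=; rewrite ts.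
Qed.

Definition cyc (a b i n : nat) : nat :=
  if (a <= n < b)%N then (a + (n - a + i) %% (b - a))%N else n.

Lemma cyc_in a b i n : (a <= n < b)%N -> (a <= cyc a b i n < b)%N.
Proof.
move=> h; rewrite /cyc h leq_addr /=.
by have := @ltn_pmod (n - a + i) (b - a); move: h; lia.
Qed.

Lemma cycK a b i : (i <= b - a)%N -> cancel (cyc a b i) (cyc a b (b - a - i)).
Proof.
move=> iL n; case h: (a <= n < b)%N; last by rewrite /cyc h h.
rewrite {1}/cyc (cyc_in i h) /cyc h addKn modnDml -addnA subnKC // modnDr.
by rewrite modn_small; lia.
Qed.

Definition mean (a b : nat) (x : nat -> R) : R :=
  (b - a)%:R^-1 * \sum_(a <= k < b) x k.

Definition avg (a b : nat) (x : nat -> R) : nat -> R :=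
  fun n => if (a <= n < b)%N then mean a b x else x n.

Lemma sum_mod_shift (F : nat -> R) L c :
  \sum_(i < L) F ((c + i) %% L)%N = \sum_(i < L) F i.
Proof.
case: L => [|L]; first by rewrite !big_ord0.
elim: c => [|c <-].
  by apply: eq_bigr => i _; rewrite add0n modn_small.
(* Raising [c] by one moves the first summand to the end. *)
rewrite big_ord_recr [RHS]big_ord_recl /= addn0 addrC addSnnS modnDr.
by congr (_ + _); apply: eq_bigr => i _; rewrite addSnnS.
Qed.

(** The [b - a] rotations carry a point of [a, b) once to each point of the interval, and fix all
    other points. *)
Lemma avgE a b x n : (a < b)%N ->
  avg a b x n = (b - a)%:R^-1 * \sum_(i < b - a) x (cyc a b i n).
Proof.
move=> ab; rewrite /avg /mean; case: ifPn => h.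
  congr (_ * _); rewrite -{1}[a]add0n big_addn big_mkord.
  rewrite -(sum_mod_shift (fun k => x (k + a)%N) (b - a) (n - a)).
  by apply: eq_bigr => i _; rewrite /cyc h addnC.
rewrite (eq_bigr (fun=> x n)) => [|i _]; last by rewrite /cyc (negPf h).
rewrite sumr_const card_ord -[x n *+ _]mulr_natl mulKf //.
by rewrite pnatr_eq0 subn_eq0 -ltnNge.
Qed.

End Rearrangement.

(** * Contractivity of averaging and the mean functionals *)

Section SymmetricSpace.
Variables (R : realType) (N : (nat -> R) -> \bar R).
Hypothesis idealN : banach_ideal_space N.
Hypothesis symN : symmetric_space N.
Implicit Types (x y : nat -> R).

Local Notation nrm x := (fine (N x)).

Lemma norm_sum_le m (y : nat -> nat -> R) (c : nat -> R) :
  (forall i, (i < m)%N -> (N (y i) <= (c i)%:E)%E) ->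
  (N (fun n => \sum_(i < m) y i n)%R <= (\sum_(i < m) c i)%:E)%E.
Proof.
elim: m => [|m IH] yc.
  by rewrite big_ord0 (_ : (fun n => _) = fun=> 0) ?norm0 //; apply/funext => n; rewrite big_ord0.
under eq_fun do rewrite big_ord_recr /=.
rewrite big_ord_recr /= EFinD; apply: le_trans (le_normD idealN _ _) _.
by apply: leeD; [apply: IH => i im; apply: yc; lia|exact: yc].
Qed.

(** By [avgE] this is a mean of sequences equimeasurable with [x], so the triangle inequality
    suffices. *)
Lemma norm_avg a b x : (a < b)%N -> (N (avg a b x) <= N x)%E.
Proof.
move=> ab; have [->|xN] := eqVneq (N x) +oo%E; first exact: leey.
have {}xN : inX N x by rewrite /inX lt_neqAle xN leey.
have L0 : (b - a)%:R != 0 :> R by rewrite pnatr_eq0 subn_eq0 -ltnNge.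
rewrite (_ : avg a b x = fun n => (b - a)%:R^-1 * \sum_(i < b - a) x (cyc a b i n)); last first.
  by apply/funext => n; rewrite avgE.
rewrite normZ // ger0_norm ?invr_ge0 //.
have -> : N x = ((b - a)%:R^-1%:E * ((\sum_(i < b - a) nrm x)%R)%:E)%E.
  by rewrite -EFinM sumr_const card_ord -[nrm x *+ _]mulr_natl mulKf // (inXE idealN).
apply: lee_wpmul2l; first by rewrite lee_fin invr_ge0.
apply: (@norm_sum_le _ (fun i n => x (cyc a b i n)) (fun=> nrm x)) => i iL.
rewrite -(inXE idealN) // (symN (x := x)) //.
apply: (rearr_comp x (cycK (ltnW iL))).
by have := @cycK a b _ (leq_subr i _); rewrite subKn 1?ltnW.
Qed.

Definition gmean a b x := nrm (chi R a b) * mean a b x.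

(** The absolute value of [gmean a b x] is the norm of the restriction of [avg a b x] to [a, b). *)
Lemma gmean_bound a b : (a < b)%N -> dual_bound N (gmean a b) 1.
Proof.
move=> ab x xN; rewrite mul1e; apply: le_trans (norm_avg x ab).
rewrite /gmean normrM ger0_norm ?fine_ge0 ?norm_ge0 // mulrC EFinM.
rewrite -(inXE idealN) ?inX_chi // -normZ //.
apply: le_norm => // n; rewrite /avg /chi; case: ifP; rewrite ?mulr1 ?mulr0 ?normr0 //.
Qed.

Lemma mean_lincomb a b (p q : R) x y :
  mean a b (lincomb p q x y) = p * mean a b x + q * mean a b y.
Proof. by rewrite /mean big_split /= -!mulr_sumr; ring. Qed.

Lemma dual_elt_gmean a b : (a < b)%N -> dual_elt N (gmean a b).
Proof.
move=> ab; split; last by exists 1; exact: gmean_bound.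
by move=> p q x y _ _; rewrite /gmean mean_lincomb; ring.
Qed.

Lemma mean_chi a b : (a < b)%N -> mean a b (chi R a b) = 1.
Proof.
move=> ab; rewrite /mean (eq_big_nat _ _ (F2 := fun=> 1)); last first.
  by move=> i h; rewrite /chi h.
by rewrite sumr_const_nat mulVf // pnatr_eq0 subn_eq0 -ltnNge.
Qed.

End SymmetricSpace.

(** * Normalised blocks and a criterion against the Dunford-Pettis property *)

Section Blocks.
Variables (R : realType) (N : (nat -> R) -> \bar R).
Hypothesis idealN : banach_ideal_space N.
Hypothesis symN : symmetric_space N.
Hypothesis reflN : reflexive_space N.
Variable a : nat -> nat.
Hypothesis a_incr : forall j, (a j < a j.+1)%N.
Implicit Types (x y : nat -> R).

Local Notation nrm x := (fine (N x)).
Local Notation chij j := (chi R (a j) (a j.+1)).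

Lemma le_block j : (j <= a j)%N.
Proof. by elim: j => // j; have := a_incr j; lia. Qed.

Lemma block_mono i j : (i <= j)%N -> (a i <= a j)%N.
Proof.
elim: j => [|j IH]; first by rewrite leqn0 => /eqP ->.
by rewrite leq_eqVlt => /predU1P[->//|/IH h]; have := a_incr j; lia.
Qed.

Definition block_vec j : nat -> R := fun n => (nrm (chij j))^-1 * chij j n.

(** Linearity is stated through [lincomb], so the scalar multiple is given a dummy second term. *)
Lemma block_vecE j :
  block_vec j = lincomb (nrm (chij j))^-1 0 (chij j) (chij j).
Proof. by apply/funext => n; rewrite /lincomb mul0r addr0. Qed.

Lemma weakly_null_block : weakly_null N block_vec.
Proof.
apply: (@weakly_null_coord _ N idealN reflN _ 1) => [j|n].
  have c0 := nrm_chi_gt0 idealN (a_incr j).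
  rewrite normZ // [X in (_ * X)%E](inXE idealN (inX_chi idealN _ _)) -EFinM lee_fin.
  by rewrite gtr0_norm ?invr_gt0 // mulVf ?gt_eqF.
apply: cvg_near_cst; exists n.+1 => // j /= nj.
have := le_block j; rewrite /block_vec /chi => ja.
by rewrite leqNgt (leq_trans nj ja) mulr0.
Qed.

Lemma gmean_block_null x : inX N x ->
  gmean N (a j) (a j.+1) x @[j --> \oo] --> 0.
Proof.
move=> xN.
apply: (@dual_null _ N idealN reflN (fun j => gmean N (a j) (a j.+1)) 1) => //.
- by move=> j; exact: dual_elt_gmean.
- by move=> j; exact: gmean_bound.
(* For [j >= n] the block starts at or beyond [n], so it misses the support [0, n) of the
   truncation. *)
move=> n; apply: cvg_near_cst; exists n => // j /= nj; rewrite /gmean /mean.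
rewrite big_nat_cond big1 ?mulr0 // => k; rewrite andbT => /andP[jk _].
have := le_block j => ja; rewrite /chi /= ltnNge.
by rewrite (leq_trans nj (leq_trans ja jk)) mul0r.
Qed.

(** Composition with the contraction [S] pulls functionals for [N] back to [M], so a bidual element
    of [M] induces one of [N], represented by a vector [x]. On the functionals [gmean \o S] it acts
    as [gmean] at [x], which tends to 0; yet their values at the blocks stay above [d]. *)
Lemma not_dunford_pettis_block M (S : (nat -> R) -> nat -> R) (d : R) :
  (forall p q x y, S (lincomb p q x y) = lincomb p q (S x) (S y)) ->
  (forall y, inX M y -> N (S y) <= M y)%E ->
  weakly_null M block_vec -> 0 < d ->
  (forall j, d <= gmean N (a j) (a j.+1) (S (block_vec j))) ->
  ~ dunford_pettis M.
Proof.
move=> Slin SM wnull d0 dS DP.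
have SN y : inX M y -> inX N (S y) by move=> yM; apply: le_lt_trans (SM y yM) yM.
have bnd f (c : R) : 0 <= c -> dual_bound N f c -> dual_bound M (f \o S) c.
  move=> c0 fc y yM; apply: le_trans (fc _ (SN y yM)) _.
  by apply: lee_wpmul2l; rewrite ?lee_fin //; exact: SM.
have dualS f : dual_elt N f -> dual_elt M (f \o S).
  move=> fN; split=> [p q x y xM yM /=|].
    by rewrite Slin (proj1 fN) //; exact: SN.
  have [c c0 fc] := dual_elt_bound idealN fN.
  by exists c; exact: bnd.
have gS j : dual_elt M (gmean N (a j) (a j.+1) \o S).
  by apply: dualS; exact: dual_elt_gmean.
have /DP : weakly_null_dual M (fun j => gmean N (a j) (a j.+1) \o S).
  split=> // Phi [Philin [c PhiC]].
  have [|x [xN xP]] := reflN (Phi := fun f => Phi (f \o S)).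
    split=> [p q f g fN gN|]; first by apply: Philin; exact: dualS.
    exists c => f K fN K0 fK.
    by apply: PhiC => //; [exact: dualS|exact: bnd].
  have PhiE j : Phi (gmean N (a j) (a j.+1) \o S) = gmean N (a j) (a j.+1) x.
    by apply: xP; exact: dual_elt_gmean.
  by under eq_fun do rewrite PhiE; exact: gmean_block_null.
move=> /(_ _ wnull) h; suff : d <= 0 by rewrite leNgt d0.
by apply: cvgr_to_ge h _; exact: nearW.
Qed.

End Blocks.

(** * Transfer of weakly null sequences from one space to another *)

Section Transfer.
Variables (R : realType) (N M : (nat -> R) -> \bar R).
Hypothesis idealN : banach_ideal_space N.
Hypothesis M_ge0 : forall x, (0 <= M x)%E.

(** A functional [f] for [M] pulls back along the [T J] to uniformly bounded functionals for [N].
    Their ultralimit is in the dual, and it agrees with [f] at each [v j] because [T J] eventually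
    fixes [v j]. *)
Lemma weakly_null_transfer (T : nat -> (nat -> R) -> nat -> R) v (C : R) :
  (forall J p q x y, T J (lincomb p q x y) = lincomb p q (T J x) (T J y)) ->
  (forall J x, inX N x -> M (T J x) <= C%:E * N x)%E ->
  (forall j, exists J0, forall J, (J0 <= J)%N -> T J (v j) = v j) ->
  weakly_null N v -> weakly_null M v.
Proof.
move=> Tlin TC Tv [vN v0].
have TM J x : inX N x -> inX M (T J x).
  by move=> xN; apply: le_lt_trans (TC J x xN) _; rewrite (inXE idealN xN) -EFinM ltry.
split=> [j|f [flin [c fc]]].
  by have [J /(_ J (leqnn J)) <-] := Tv j; exact: TM.
have bnd J : dual_bound N (f \o T J) (`|c| * C).
  move=> x xN; apply: le_trans (fc _ (TM J x xN)) _.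
  apply: (@le_trans _ _ (`|c|%:E * M (T J x))%E).
    by apply: lee_wpmul2r; rewrite ?M_ge0 // lee_fin ler_norm.
  by rewrite EFinM -muleA; apply: lee_wpmul2l; rewrite ?lee_fin //; exact: TC.
have gN J : dual_elt N (f \o T J).
  split=> [p q x y xN yN /=|]; last by exists (`|c| * C); exact: bnd.
  by rewrite Tlin flin //; exact: TM.
have [U [UF ooU]] := ultraFilterLemma (F := \oo) _.
have UP : ProperFilter U := @ultra_proper _ U UF.
have := v0 _ (dual_elt_ulim idealN UF gN bnd).
rewrite (_ : (fun m => _) = f \o v) //; apply/funext => j /=.
apply/cvg_lim => //; apply: cvg_near_cst; apply: ooU.
by have [J0 TJ] := Tv j; exists J0 => // J /= /TJ ->.
Qed.

End Transfer.

(** * The Cesàro space *)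

Section Cesaro.
Variables (R : realType) (N : (nat -> R) -> \bar R).
Hypothesis idealN : banach_ideal_space N.
Hypothesis symN : symmetric_space N.
Hypothesis reflN : reflexive_space N.

Lemma Cd_lincomb (p q : R) x y :
  Cd (lincomb p q x y) = lincomb p q (Cd x) (Cd y).
Proof.
apply/funext => n; rewrite /Cd /lincomb big_split /= -!mulr_sumr; ring.
Qed.

Lemma norm_Cd_le (x : nat -> R) : (N (Cd x) <= cesaro_space N x)%E.
Proof.
apply: le_norm => // n; rewrite /Cd !normrM ler_wpM2l //.
by rewrite [leRHS]ger0_norm ?sumr_ge0 // ler_norm_sum.
Qed.

(** Truncated subtraction gives the correct value 0 while [n < a]. *)
Lemma sum_chi a b n : (n < b)%N ->
  \sum_(k < n.+1) chi R a b k = (n.+1 - a)%:R.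
Proof.
elim: n => [|n IH] nb.
  by rewrite big_ord1 /chi leqn0 nb andbT; case: a.
rewrite big_ord_recr /= IH 1?ltnW // /chi nb andbT -natrD; congr _%:R.
by case: leqP; lia.
Qed.

(** At index [a + i] the Cesàro mean is (i+1)/(a+i+1), at least (i+1)/(2a); averaging over [i < a]
    gives (a+1)/(4a). *)
Lemma mean_Cd_chi a : (0 < a)%N -> 4^-1 <= mean a (a + a) (Cd (chi R a (a + a))).
Proof.
move=> a0; have a0R : 0 < a%:R :> R by rewrite ltr0n.
rewrite /mean addnK -{1}[a in \sum_(a <= _ < _) _]add0n big_addn addnK big_mkord.
have gauss m : \sum_(i < m) i.+1%:R = m%:R * m.+1%:R / 2 :> R.
  elim: m => [|m IH]; first by rewrite big_ord0 !mul0r.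
  by rewrite big_ord_recr /= IH -!natr1; field.
apply: (@le_trans _ _ (a%:R^-1 * \sum_(i < a) i.+1%:R / (a%:R + a%:R))); last first.
  rewrite ler_wpM2l ?invr_ge0 ?ler0n //; apply: ler_sum => i _.
  have ia := ltn_ord i; rewrite /Cd sum_chi; last lia.
  rewrite (_ : (i + a).+1 - a = i.+1)%N; last lia.
  rewrite mulrC ler_wpM2r ?ler0n // lef_pV2 ?posrE -?natrD ?ltr0n ?ler_nat; lia.
rewrite -mulr_suml gauss -[a.+1%:R]natr1.
rewrite (_ : _ * _ = (a%:R + 1) / a%:R / 4); last by field; rewrite !gt_eqF ?addr_gt0.
by rewrite -[leLHS]mul1r ler_pM2r ?invr_gt0 // ler_pdivlMr // mul1r lerDl.
Qed.

Lemma cesaro_not_dunford_pettis :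
  cesaro_bounded N -> ~ dunford_pettis (cesaro_space N).
Proof.
(* Dyadic endpoints give blocks [a, 2a), the form treated by [mean_Cd_chi]. *)
move=> [c cN]; pose a j := (2 ^ j)%N.
have a_incr j : (a j < a j.+1)%N by rewrite ltn_exp2l.
apply: (@not_dunford_pettis_block _ N idealN symN reflN a a_incr _ (@Cd R) 4^-1).
- exact: Cd_lincomb.
- by move=> y _; exact: norm_Cd_le.
(* All [T J] are the identity: the bound [c] for [Cd] bounds the inclusion into the Cesàro space. *)
- apply: (@weakly_null_transfer _ N _ idealN _ (fun=> id) _ c) => //.
  + by move=> x; exact: (norm_ge0 idealN).
  + move=> _ x xN; have xE : N (fun n => `|x n|) = N x.
      by apply/le_anti/andP; split; apply: le_norm => // n; rewrite normr_id.
    by rewrite /cesaro_space -xE; apply: cN; rewrite /inX xE.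
  + by move=> j; exists 0%N.
  + exact: weakly_null_block.
- by rewrite invr_gt0.
move=> j; have c0 := nrm_chi_gt0 idealN (a_incr j).
set cj := chi R (a j) (a j.+1) in c0 *.
rewrite block_vecE -/cj Cd_lincomb /gmean mean_lincomb mul0r addr0 mulVKf ?gt_eqF //.
rewrite /cj /a expnS mul2n -addnn; apply: mean_Cd_chi.
by rewrite expn_gt0.
Qed.

End Cesaro.

(** * Growth of the norms of indicators and the choice of sparse blocks *)

Section FundamentalFunction.
Variables (R : realType) (N : (nat -> R) -> \bar R).
Hypothesis idealN : banach_ideal_space N.
Hypothesis symN : symmetric_space N.
Hypothesis reflN : reflexive_space N.

Local Notation nrm x := (fine (N x)).

(** Rotating [0, n+1) by [n] places sends index 0 to [n], so the two unit vectors are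
    equimeasurable. *)
Lemma norm_chi1 n : N (chi R n n.+1) = N (chi R 0 1).
Proof.
apply: symN; rewrite /equimeasurable.
have nL : (n <= n.+1 - 0)%N by lia.
have nK := cycK nL; have := cycK (leq_subr n (n.+1 - 0)).
rewrite subKn // => nK'; rewrite (rearr_comp (chi R n n.+1) nK nK').
congr rearr; apply/funext => k; rewrite /= /chi /cyc leq0n /= subn0 add0n.
rewrite subn0; congr (nat_of_bool _)%:R; rewrite ltnS -eqn_leq.
case: ltnP => [kn|]; last by lia.
case: k kn => [|k] kn; first by rewrite add0n modn_small ?eqxx.
rewrite addSnnS modnDr modn_small; lia.
Qed.

Lemma nrm_chi_le a b c d : (c <= a)%N -> (b <= d)%N ->
  nrm (chi R a b) <= nrm (chi R c d).
Proof.
move=> ca bd; rewrite -lee_fin -!(inXE idealN) ?inX_chi //.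
apply: le_norm => // n; rewrite /chi !normr_nat ler_nat.
lia.
Qed.

(* If the fundamental function were bounded, the constant sequence 1 would lie
   in X as an ultralimit of the [chi 0 n], whereas elements of X tend to 0. *)
Lemma nrm_chi_unbounded (K : R) : exists n, K < nrm (chi R 0 n).
Proof.
apply: contrapT => /forallNP bounded.
have bnd n : (N (chi R 0 n) <= K%:E)%E.
  by rewrite inXE ?inX_chi // lee_fin leNgt; apply/negP.
have [U [UF ooU]] := ultraFilterLemma (F := \oo) _.
have UP : ProperFilter U := @ultra_proper _ U UF.
have [x xN xU] := bounded_ulim idealN reflN UF bnd.
have x1 n : x n = 1.
  apply: (@cvg_unique _ _ (chi R 0 m n @[m --> U])) => //.
    exact: (xU _ (dual_elt_coord idealN n)).
  by apply: cvg_near_cst; apply: ooU; exists n.+1 => // m /= nm; rewrite /chi nm.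
(* For [a = id] the blocks are singletons, and [gmean] is a coordinate times the common norm of the
   unit vectors. *)
have := gmean_block_null idealN symN reflN (a := id) ltnSn xN.
have c0 : 0 < nrm (chi R 0 1) by exact: nrm_chi_gt0.
move=> h; suff : nrm (chi R 0 1) <= 0 by rewrite leNgt c0.
apply: cvgr_to_ge h _; apply: nearW => n.
by rewrite /gmean /mean norm_chi1 big_nat1 x1 subSnn invr1 !mulr1.
Qed.

(** Greedy choice: once the norm of [chi R 0 b] exceeds 2^j + 1 times that of [chi R 0 m], the
    triangle inequality leaves the factor 2^j for [chi R m b]. *)
Lemma sparse_blocks : exists a : nat -> nat,
  (forall j, (a j < a j.+1)%N) /\
  forall j, 2 ^+ j * nrm (chi R 0 (a j)) <= nrm (chi R (a j) (a j.+1)).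
Proof.
have step (jm : nat * nat) : exists b, (jm.2 < b)%N /\
    2 ^+ jm.1 * nrm (chi R 0 jm.2) <= nrm (chi R jm.2 b).
  case: jm => j m /=.
  have [b bP] := nrm_chi_unbounded (2 ^+ j * nrm (chi R 0 m) + nrm (chi R 0 m)).
  have c0 : 0 <= nrm (chi R 0 m) by rewrite fine_ge0 ?norm_ge0.
  have p0 : 0 <= 2 ^+ j * nrm (chi R 0 m) by rewrite mulr_ge0 ?exprn_ge0.
  exists b; have mb : (m < b)%N.
    rewrite ltnNge; apply/negP => bm.
    have := @nrm_chi_le 0 b 0 m (leqnn 0) bm; lra.
  split=> //; suff : nrm (chi R 0 b) <= nrm (chi R 0 m) + nrm (chi R m b) by lra.
  rewrite -lee_fin EFinD -!(inXE idealN) ?inX_chi //.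
  apply: le_trans (le_normD idealN _ _); apply: le_norm => // n.
  by rewrite /chi -natrD !normr_nat ler_nat; lia.
have [s sP] := choice step.
pose a := fix a j := if j is i.+1 then s (i, a i) else 0%N.
by exists a; split=> j; have [] := sP (j, a j).
Qed.

End FundamentalFunction.

(** * The tilde space and block averaging projections into it *)

Section Tilde.
Variables (R : realType) (N : (nat -> R) -> \bar R).
Hypothesis idealN : banach_ideal_space N.
Hypothesis symN : symmetric_space N.
Hypothesis reflN : reflexive_space N.
Implicit Types x y : nat -> R.

Local Notation nrm x := (fine (N x)).

Lemma tilde_ge0 x : (0 <= tilde_space N x)%E.
Proof. by rewrite /tilde_space; case: ifP => // _; exact: norm_ge0. Qed.

Lemma norm_le_tilde x : (N x <= tilde_space N x)%E.
Proof.
rewrite /tilde_space; case: ifPn => [/asboolP[M xM]|_]; last exact: leey.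
apply: le_norm => // n; apply: le_trans (ler_norm _).
by apply: ub_le_sup; [exists M => _ [k _ <-]|exists n => /=].
Qed.

(** Such a [w] dominates the least decreasing majorant of |x|. *)
Lemma tilde_le x (w : nat -> R) :
  (forall n k, (n <= k)%N -> `|x k| <= w n) -> (tilde_space N x <= N w)%E.
Proof.
move=> xw; rewrite /tilde_space ifT; last first.
  by apply/asboolP; exists (w 0%N) => k; exact: xw.
apply: le_norm => // n; have w0 : 0 <= w n by apply: le_trans (xw n n _).
have ub : ubound [set `|x k| | k in [set k | (n <= k)%N]] (w n).
  by move=> _ [k nk <-]; exact: xw.
rewrite (ger0_norm w0) ger0_norm; first by apply: ge_sup ub; exists `|x n|; exists n => /=.
apply: le_trans (normr_ge0 (x n)) _.
by apply: ub_le_sup; [exists (w n)|exists n => /=].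
Qed.

Variable a : nat -> nat.
Hypothesis a_incr : forall j, (a j < a j.+1)%N.

Local Notation chij j := (chi R (a j) (a j.+1)).
Local Notation meanj j := (mean (a j) (a j.+1)).

(** Unlike [blockproj], this keeps the coordinates outside the first [J] blocks, so iterating
    [norm_avg] shows that it is contractive. *)
Fixpoint blockavg J x : nat -> R :=
  if J is i.+1 then avg (a i) (a i.+1) (blockavg i x) else x.

Lemma norm_blockavg J x : (N (blockavg J x) <= N x)%E.
Proof. by elim: J => //= J; apply: le_trans; exact: norm_avg. Qed.

Lemma blockavg_out J x n : (a J <= n)%N -> blockavg J x n = x n.
Proof.
elim: J => //= J IH Jn; rewrite /avg ltnNge Jn andbF IH //.
by have := a_incr J; lia.
Qed.

(** The projection onto the span of the first [J] block indicators, used as [T J] in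
    [weakly_null_transfer]. *)
Definition blockproj J x : nat -> R := fun n => \sum_(j < J) meanj j x * chij j n.

Lemma sum_chi_out J (c : nat -> R) n : (a J <= n)%N ->
  \sum_(j < J) c j * chij j n = 0.
Proof.
move=> Jn; apply: big1 => j _; rewrite /chi.
have := block_mono a_incr (ltn_ord j) => jJ.
by rewrite [(n < _)%N]ltnNge (leq_trans jJ Jn) andbF mulr0.
Qed.

Lemma norm_mean_le p q x : `|mean p q x| <= mean p q (fun k => `|x k|).
Proof.
by rewrite /mean normrM ger0_norm ?invr_ge0 // ler_wpM2l ?invr_ge0 // ler_norm_sum.
Qed.

(** Averaging over earlier blocks leaves block [J] untouched, so the next average there is that of
    |x| itself. *)
Lemma sum_mean_le_blockavg J x n :
  \sum_(j < J) `|meanj j x| * chij j n <= blockavg J (fun k => `|x k|) n.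
Proof.
elim: J => [|J IH]; first by rewrite big_ord0 /=.
rewrite big_ord_recr /= /avg /chi; case: ifPn => h; last by rewrite mulr0 addr0.
rewrite mulr1 (@sum_chi_out _ (fun j => `|meanj j x|)) ?add0r; last by case/andP: h.
apply: le_trans (norm_mean_le _ _ _) _.
rewrite /mean ler_wpM2l ?invr_ge0 //; apply: ler_sum_nat => k /andP[Jk _].
by rewrite blockavg_out.
Qed.

Hypothesis a_sparse :
  forall j, 2 ^+ j * nrm (chi R 0 (a j)) <= nrm (chij j).

(** Contractivity of [gmean] controls the mean against the norm of the block; sparseness passes to
    the initial interval and gains 2^-j. *)
Lemma mean_sparse_le j x : inX N x ->
  `|meanj j x| * nrm (chi R 0 (a j)) <= 2 ^- j * nrm x.
Proof.
move=> xN; have := dual_boundE idealN (gmean_bound idealN symN (a_incr j)) xN.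
rewrite mul1r /gmean normrM ger0_norm ?fine_ge0 ?norm_ge0 // => h.
rewrite ler_pdivlMl ?exprn_gt0 //; apply: le_trans h.
by rewrite mulrCA mulrC ler_wpM2r.
Qed.

Lemma geometric_le2 J : \sum_(j < J) 2 ^- j <= 2 :> R.
Proof.
suff -> : \sum_(j < J) 2 ^- j = 2 - 2 * 2 ^- J :> R.
  by rewrite lerBlDr lerDl mulr_ge0 ?invr_ge0 ?exprn_ge0.
elim: J => [|J IH]; first by rewrite big_ord0 expr0 invr1; ring.
by rewrite big_ord_recr /= IH exprS; field; rewrite expf_neq0.
Qed.

(** Spreading the height of block [j] over all of [0, a (j+1)) gives the decreasing majorant
    [w1 + w2]. The block part [w1] costs one norm of [x] by contractivity of [blockavg]; the initial
    part [w2] costs at most two by the geometric series. *)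
Lemma tilde_blockproj J x : inX N x ->
  (tilde_space N (blockproj J x) <= 3%:E * N x)%E.
Proof.
move=> xN.
pose w1 n := \sum_(j < J) `|meanj j x| * chij j n.
pose w2 n := \sum_(j < J) `|meanj j x| * chi R 0 (a j) n.
apply: (@le_trans _ _ (N (fun n => w1 n + w2 n)%R)).
  apply: tilde_le => n k nk; rewrite /w1 /w2 -big_split /=.
  apply: le_trans (ler_norm_sum _ _ _) _; apply: ler_sum => j _.
  rewrite normrM -mulrDr ler_wpM2l // /chi normr_nat -natrD ler_nat.
  by have := a_incr j; lia.
apply: le_trans (le_normD idealN _ _) _.
rewrite (_ : 3%:E = 1 + 2%:E)%E; last by rewrite -EFinD; congr EFin; ring.
rewrite ge0_muleDl ?lee_fin // mul1e; apply: leeD.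
  apply: (@le_trans _ _ (N (fun k => `|x k|)%R)).
    apply: le_trans (norm_blockavg J _); apply: le_norm => // n.
    rewrite [leLHS]ger0_norm; last by apply: sumr_ge0 => j _; rewrite mulr_ge0.
    by apply: le_trans (ler_norm _); exact: sum_mean_le_blockavg.
  by apply: le_norm => // n; rewrite normr_id.
apply: (@le_trans _ _ (\sum_(j < J) 2 ^- j * nrm x)%R%:E).
  apply: (@norm_sum_le _ N idealN J (fun j n => `|meanj j x| * chi R 0 (a j) n)
    (fun j => 2 ^- j * nrm x)) => j _.
  rewrite normZ // normr_id [X in (_ * X)%E](inXE idealN (inX_chi idealN _ _)).
  by rewrite -EFinM lee_fin mean_sparse_le.
rewrite [X in (_ * X)%E](inXE idealN xN) -EFinM lee_fin -mulr_suml.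
by rewrite ler_wpM2r ?fine_ge0 ?norm_ge0 ?geometric_le2 //.
Qed.

Lemma blockproj_lincomb J (p q : R) x y :
  blockproj J (lincomb p q x y) = lincomb p q (blockproj J x) (blockproj J y).
Proof.
apply/funext => n; rewrite /blockproj /lincomb !mulr_sumr -big_split /=.
by apply: eq_bigr => j _; rewrite mean_lincomb; ring.
Qed.

Lemma blockproj_chi J j : (j < J)%N -> blockproj J (chij j) = chij j.
Proof.
move=> jJ; apply/funext => n; rewrite /blockproj (bigD1 (Ordinal jJ)) //=.
rewrite mean_chi // mul1r big1 ?addr0 // => i; rewrite -val_eqE /= => ij.
rewrite /mean big_nat_cond big1 ?mulr0 ?mul0r // => k; rewrite andbT /chi.
move=> /andP[ik ki]; case: (boolP (a j <= k < a j.+1)%N) => // /andP[jk kj]; exfalso.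
by case: (ltngtP i j) ij => // h _; have := block_mono a_incr h; lia.
Qed.

Lemma tilde_not_dunford_pettis_sparse : ~ dunford_pettis (tilde_space N).
Proof.
(* Here [S] is the identity, contractive because the tilde norm dominates [N], and the pairing is
   exactly 1. *)
apply: (@not_dunford_pettis_block _ N idealN symN reflN a a_incr _ id 1) => //.
- by move=> y _; exact: norm_le_tilde.
- apply: (@weakly_null_transfer _ N _ idealN tilde_ge0 blockproj _ 3).
  + exact: blockproj_lincomb.
  + by move=> J x; exact: tilde_blockproj.
  + move=> j; exists j.+1 => J jJ.
    by rewrite block_vecE blockproj_lincomb blockproj_chi.
  + exact: weakly_null_block.
move=> j; have c0 := nrm_chi_gt0 idealN (a_incr j).
by rewrite block_vecE /gmean mean_lincomb mul0r addr0 mean_chi // mulr1 mulfV ?gt_eqF.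
Qed.

End Tilde.

Theorem theorem6 (R : realType) (N : (nat -> R) -> \bar R) :
  banach_ideal_space N -> symmetric_space N -> reflexive_space N ->
  (cesaro_bounded N -> ~ dunford_pettis (cesaro_space N)) /\
  (cesaro_bounded (kothe_dual N) -> ~ dunford_pettis (tilde_space N)).
Proof.
move=> idealN symN reflN; split=> [|_]; first exact: cesaro_not_dunford_pettis.
have [a [a_incr a_sparse]] := sparse_blocks idealN symN reflN.
exact: tilde_not_dunford_pettis_sparse a_incr a_sparse.
Qed.
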